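(* For every integer $d\ge1$ there are constants $c_1,c_2>0$ depending only on $d$ such that the following holds. Let $G=(V,E)$ be a weakly observable undirected graph with $|V|=N$ in which every vertex has degree at most $d$. Then for all sufficiently large $T$ (how large may depend on $G$), the mini-max regret satisfies $$c_1\,N^{\frac13}\cdot T^{\frac23}\le R_G^*(T)\le c_2\,N^{\frac13}\cdot T^{\frac23}.$$
   Context: **Problem (bandit with graph feedback).** $G=(V,E)$ is a finite directed graph, possibly with self-loops (an undirected graph is viewed as directed by understanding an undirected edge $\{u,v\}$ as the two directed edges $(u,v)$ and $(v,u)$); vertices are called arms. $N_{\mathrm{in}}(v)=\{u:(u,v)\in E\}$, $N_{\mathrm{out}}(v)=\{u:(v,u)\in E\}$. The player knows $G$ and the horizon $T$. In each round $t=1,\dots,T$ the player's (randomized) algorithm computes from past observations a distribution on $V$ and samples an arm $A_t$ from it; there is a loss vector $\ell^{(t)}:V\to[0,1]$; the player pays $\ell^{(t)}(A_t)$ and observes exactly the values $\ell^{(t)}(v)$ for $v\in N_{\mathrm{out}}(A_t)$. For an algorithm $\mathcal A$ and a fixed loss sequence $\mathcal L$, the regret with respect to arm $a$ is $R_a(G,T,\mathcal A,\mathcal L)=\mathbf E[\sum_{t=1}^T\ell^{(t)}(A_t)]-\sum_{t=1}^T\ell^{(t)}(a)$. The mini-max regret is $R_G^*(T)=\inf_{\mathcal A}\sup_{\mathcal L}R_{a^*}(G,T,\mathcal A,\mathcal L)$, where $a^*\in\arg\min_a\sum_t\ell^{(t)}(a)$. **Observability.** A vertex $v$ is non-observable if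 $N_{\mathrm{in}}(v)=\emptyset$; it is strongly observable if it has a self-loop or $N_{\mathrm{in}}(v)=V\setminus\{v\}$. A graph is non-observable if it has a non-observable vertex, strongly observable if all its vertices are strongly observable, and weakly observable if it is neither non-observable nor strongly observable. *)

(* Defs.v *)
From HB Require Import structures.
From mathcomp Require Import all_boot all_order all_algebra.
From mathcomp Require Import all_classical all_reals all_analysis.

Set Implicit Arguments.
Unset Strict Implicit.
Unset Printing Implicit Defensive.

Import Order.TTheory GRing.Theory Num.Theory.

Local Open Scope classical_set_scope.
Local Open Scope ring_scope.

Section Observability.
Variables (V : finType) (E : rel V).

Definition N_in (v : V) : {set V} := [set u | E u v]%SET.
Definition N_out (v : V) : {set V} := [set u | E v u]%SET.

Definition vertex_non_observable (v : V) : bool := N_in v == finset.set0.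

Definition vertex_strongly_observable (v : V) : bool :=
  E v v || (N_in v == [set~ v]%SET).

Definition non_observable : bool := [exists v, vertex_non_observable v].

Definition strongly_observable : bool :=
  [forall v, vertex_strongly_observable v].

Definition weakly_observable : bool :=
  ~~ non_observable && ~~ strongly_observable.

End Observability.

(* An undirected graph is given by its edge sets {u, v} with u and v distinct,
   each read as the two arcs (u, v) and (v, u), so it has no self-loop. *)
Definition undirected (V : finType) (E : rel V) : Prop :=
  symmetric E /\ irreflexive E.

Section Bandit.
Variables (R : realType) (V : finType).

(* One entry per past round, oldest first: the arm played, and the losses
   observed in that round, with None at the arms that were not observed. *)
Definition history : Type := seq (V * {ffun V -> option R}).

(* The length of the history tells the round; the knowledge of the graph and
   of the horizon is reflected by the infimum in minimax_regret being taken for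
   a fixed graph and a fixed horizon. *)
Record algorithm := Algorithm {
  arm_prob :> history -> V -> R ;
  arm_prob_ge0 : forall h v, 0 <= arm_prob h v ;
  arm_prob_sum1 : forall h, \sum_v arm_prob h v = 1
}.

Variable E : rel V.

Definition feedback (l : V -> R) (a : V) : {ffun V -> option R} :=
  [ffun v => if v \in N_out E a then Some (l v) else None].

Variable T : nat.
Implicit Types (A : algorithm) (L : 'I_T -> V -> R) (w : {ffun 'I_T -> V}).

Definition loss_sequence L : Prop := forall t v, 0 <= L t v <= 1.

Definition past L w (t : 'I_T) : history :=
  [seq (w s, feedback (L s) (w s)) | s : 'I_T <- enum 'I_T & (s < t)%N].

(* Against a fixed loss sequence, the law of the arms (A_1, ..., A_T) is a
   finitely supported one, given by the chain rule. *)
Definition play_prob A L w : R := \prod_(t < T) A (past L w t) (w t).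

Definition expected_loss A L : R :=
  \sum_(w : {ffun 'I_T -> V}) play_prob A L w * \sum_(t < T) L t (w t).

Definition regret A L (a : V) : R := expected_loss A L - \sum_(t < T) L t a.

Definition best_arm L (a : V) : Prop :=
  forall b, \sum_(t < T) L t a <= \sum_(t < T) L t b.

Definition worst_regret A : \bar R :=
  ereal_sup [set x | exists L a,
    [/\ loss_sequence L, best_arm L a & x = (regret A L a)%:E]].

Definition minimax_regret : \bar R := ereal_inf (range worst_regret).

End Bandit.

(* Main.v *)
Require Import Defs.
From HB Require Import structures.
From mathcomp Require Import all_boot all_order all_algebra.
From mathcomp Require Import all_classical all_reals all_analysis.
From mathcomp Require Import ring lra.

Set Implicit Arguments.
Unset Strict Implicit.
Unset Printing Implicit Defensive.

Import Order.TTheory GRing.Theory Num.Theory.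
Import numFieldNormedType.Exports.

Local Open Scope classical_set_scope.
Local Open Scope ring_scope.

(* Upper bound, without logarithm.  Keep a distribution p over the arms; with
   probability 1 - gamma play an arm i drawn from p, and with probability gamma
   play a fixed neighbour f i of such an arm.  Arm i is then observed with
   probability at least gamma p_i, as if one had bandit feedback a fraction gamma
   of the time, and the Tsallis-entropy mirror descent run on the
   importance-weighted losses has regret O(sqrt N / eta + eta T sqrt N / gamma)
   + gamma T; the choices gamma = (N / T)^(1/3) and eta = sqrt (gamma / T) give
   N^(1/3) T^(2/3).

   Lower bound.  Take an independent set I with |I| >= max (2, N / (d + 1)).  Arms
   outside I always lose 1, arms in I lose a fair coin.  Playing in I reveals no
   coin, and playing outside costs 1/2 and reveals at most d coins.  If the
   regret is at most x, there are at most 2 x plays outside I, so on average an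
   arm of I is observed at most 2 d x / |I| times, which is too few to notice
   that the mean loss of that arm has been lowered by eps, for eps of order
   (N / T)^(1/3). *)

(** * Expectations over trajectories *)

Section Expectation.
Variables (R : realType) (X : finType) (Y : Type).
Variables (e : nat -> X -> Y) (K : seq Y -> X -> R).

(** [K s] is the law of the next draw given the record [s], and [e] turns a draw into its entry.
    Integrating out the last round first lets one-round bounds be iterated by induction. *)
Fixpoint expect (n : nat) (f : seq Y -> R) : R :=
  if n is m.+1 then expect m (fun s => \sum_x K s x * f (rcons s (e m x)))
  else f [::].

Lemma big_ffun_recr n (F : {ffun 'I_n.+1 -> X} -> R) :
  \sum_x F x = \sum_(y : {ffun 'I_n -> X}) \sum_(v : X)
    F [ffun i => if unlift ord_max i is Some j then y j else v].
Proof.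
rewrite pair_big /=.
pose ext (p : {ffun 'I_n -> X} * X) : {ffun 'I_n.+1 -> X} :=
  [ffun i => if unlift ord_max i is Some j then p.1 j else p.2].
pose res (x : {ffun 'I_n.+1 -> X}) :=
  ([ffun j => x (lift ord_max j)] : {ffun 'I_n -> X}, x ord_max).
rewrite (reindex ext) //; exists res => [[y v] _|x _].
  rewrite /res /ext; congr pair; last by rewrite ffunE unlift_none.
  by apply/ffunP => j; rewrite !ffunE liftK.
apply/ffunP => i; rewrite /ext /res !ffunE.
by case: unliftP => [j ->|->] /=; rewrite ?ffunE.
Qed.

(** Splitting off the last coordinate turns the chain-rule product over trajectories into one
    conditional average; this brings sums over [play_prob] under [expect]. *)
Lemma expectE n f :
  \sum_(x : {ffun 'I_n -> X})
    (\prod_(t < n) K [seq e s (x s) | s : 'I_n <- enum 'I_n & (s < t)%N] (x t)) *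
    f [seq e s (x s) | s : 'I_n <- enum 'I_n] = expect n f.
Proof.
elim: n f => [|n IHn] f.
  rewrite /= (bigD1 [ffun i : 'I_0 => match notF (ltn_ord i) with end]) //=.
  rewrite big_ord0 mul1r (_ : enum 'I_0 = [::]); last first.
    by apply: size0nil; rewrite size_enum_ord.
  rewrite big1 ?addr0// => y /eqP[]; apply/ffunP => -[] //.
rewrite /= -IHn big_ffun_recr; apply: eq_bigr => y _.
rewrite mulr_sumr; apply: eq_bigr => v _.
set x := finfun _.
have xw (j : 'I_n) : x (widen_ord (leqnSn n) j) = y j.
  rewrite /x ffunE (_ : widen_ord _ j = lift ord_max j) ?liftK//.
  by apply: val_inj; rewrite /= /bump leqNgt ltn_ord.
have xm : x ord_max = v by rewrite /x ffunE unlift_none.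
have pre (t : nat) : (t <= n)%N ->
    [seq e s (x s) | s : 'I_n.+1 <- enum 'I_n.+1 & (s < t)%N] =
    [seq e s (y s) | s : 'I_n <- enum 'I_n & (s < t)%N].
  move=> tn; rewrite enum_ordSr filter_rcons /= ltnNge tn /= filter_map -map_comp.
  by apply: eq_map => j /=; rewrite xw.
rewrite big_ord_recr /= xm pre//.
have full : [seq e s (x s) | s : 'I_n.+1 <- enum 'I_n.+1] =
    rcons [seq e s (y s) | s : 'I_n <- enum 'I_n] (e n v).
  rewrite enum_ordSr map_rcons -map_comp /= xm; congr rcons.
  by apply: eq_map => j /=; rewrite xw.
rewrite full mulrA; congr (_ * K _ _ * _).
  by apply: eq_bigr => j _; rewrite xw pre//= ltnW.
by rewrite (eq_in_filter (a2 := predT)) ?filter_predT// => j _; apply: ltn_ord.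
Qed.

Lemma eq_expect n f g :
  (forall s, size s = n -> f s = g s) -> expect n f = expect n g.
Proof.
elim: n f g => [|n IHn] f g fg /=; first exact: fg.
by apply: IHn => s sn; apply: eq_bigr => x _; rewrite fg ?size_rcons ?sn.
Qed.

Lemma expectD n f g :
  expect n (fun s => f s + g s) = expect n f + expect n g.
Proof.
elim: n f g => [//|n IHn] f g /=; rewrite -IHn; apply: eq_expect => s _.
by rewrite -big_split /=; apply: eq_bigr => x _; rewrite mulrDr.
Qed.

Lemma expectZ n a f : expect n (fun s => a * f s) = a * expect n f.
Proof.
elim: n f => [//|n IHn] f /=; rewrite -IHn; apply: eq_expect => s _.
by rewrite mulr_sumr; apply: eq_bigr => x _; rewrite mulrCA.
Qed.

Lemma expect_sum (I : finType) (P : {pred I}) n (f : I -> seq Y -> R) :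
  expect n (fun s => \sum_(i in P) f i s) = \sum_(i in P) expect n (f i).
Proof.
elim: n f => [//|n IHn] f /=; rewrite -IHn; apply: eq_expect => s _.
by rewrite exchange_big; apply: eq_bigr => x _; rewrite mulr_sumr.
Qed.

Hypothesis K_ge0 : forall s x, 0 <= K s x.
Hypothesis K_sum1 : forall s, \sum_x K s x = 1.

Lemma le_expect n f g :
  (forall s, size s = n -> f s <= g s) -> expect n f <= expect n g.
Proof.
elim: n f g => [|n IHn] f g fg /=; first exact: fg.
apply: IHn => s sn; apply: ler_sum => x _; apply: ler_wpM2l => //.
by rewrite fg// size_rcons sn.
Qed.

Lemma expect_cst n c : expect n (fun=> c) = c.
Proof.
elim: n => [//|n IHn] /=; rewrite -[RHS]IHn; apply: eq_expect => s _.
by rewrite -mulr_suml K_sum1 mul1r.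
Qed.

(** A supermartingale bound: [f s - b * size s] does not increase in conditional mean. *)
Lemma expect_drift n f b :
  (forall m s, (m < n)%N -> \sum_x K s x * f (rcons s (e m x)) <= f s + b) ->
  expect n f <= f [::] + b * n%:R.
Proof.
elim: n => [|n IHn] fb /=; first by rewrite mulr0 addr0.
apply: (@le_trans _ _ (expect n (fun s => f s + b))).
  by apply: le_expect => s _; apply: fb.
rewrite expectD expect_cst -natr1 mulrDr mulr1 addrA lerD2r.
by apply: IHn => m s mn; apply: fb; rewrite ltnS ltnW.
Qed.

End Expectation.

Section AdditiveExpectation.
Variables (R : realType) (X : finType) (K : seq X -> X -> R).
Hypothesis K_ge0 : forall s x, 0 <= K s x.
Hypothesis K_sum1 : forall s, \sum_x K s x = 1.

(** The difference of the two sums has nonpositive drift, so a one-round comparison suffices. *)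
Lemma expect_additive_le n (g h : X -> R) :
  (forall s, \sum_x K s x * g x <= \sum_x K s x * h x) ->
  expect (fun=> id) K n (fun s => \sum_(x <- s) g x) <=
  expect (fun=> id) K n (fun s => \sum_(x <- s) h x).
Proof.
move=> gh; pose f (s : seq X) := \sum_(x <- s) g x - \sum_(x <- s) h x.
rewrite [leLHS](@eq_expect _ _ _ _ _ n _ (fun s => f s + \sum_(x <- s) h x)).
  2: by move=> s _; rewrite /f subrK.
rewrite expectD gerDr.
apply: le_trans (@expect_drift _ _ _ _ _ K_ge0 K_sum1 n f 0 _) _; last first.
  by rewrite /f !big_nil subrr mul0r addr0.
move=> m s _; rewrite addr0.
rewrite (eq_bigr (fun x => K s x * f s + (K s x * g x - K s x * h x))).
  by rewrite big_split -mulr_suml K_sum1 mul1r gerDl sumrB subr_le0; apply: gh.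
by move=> x _; rewrite /f !big_rcons /=; ring.
Qed.

End AdditiveExpectation.

(** * Real inequalities *)

(** For [s i = (M i + y)^-1] the shift [y] must normalise the sum of squares. At [y = 1 - min M] one
    term is already 1; at [y = N - min M] each of the N terms is at most [N^-2]; the intermediate
    value theorem gives [y], and [x = - y]. *)
Lemma tsallis_exists (R : realType) (V : finType) (v0 : V) (M : V -> R) :
  exists s : V -> R, [/\ forall i, 0 < s i, \sum_i s i ^+ 2 = 1 &
    exists x, forall i, M i = x + (s i)^-1].
Proof.
have [i0 Mi0] : exists i0, forall i, M i0 <= M i.
  by exists [arg min_(i < v0) M i]%O; case: arg_minP => // i _ Mi j; apply: Mi.
have N1 : 1 <= #|V|%:R :> R by rewrite ler1n; apply/card_gt0P; exists v0.
pose f (y : R) := \sum_i (M i + y)^-1 ^+ 2.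
have pos (y : R) i : 1 - M i0 <= y -> 1 <= M i + y.
  by move=> y1; move: (Mi0 i) => ?; lra.
have [|||y yab fy1] := @IVT R f (1 - M i0) (#|V|%:R - M i0) 1.
- by rewrite lerD2r.
- apply: continuous_in_subspaceT => y; rewrite inE /= in_itv /= => /andP[y1 _].
  apply: (@cvg_big _ _ +%R 0 predT); first exact: add_continuous.
  move=> i _; rewrite expr2.
  under eq_fun do rewrite expr2.
  have cV : (M i + x)^-1 @[x --> y] --> (M i + y)^-1.
    apply: cvgV; first by rewrite gt_eqF// (lt_le_trans ltr01)// pos.
    by apply: cvgD; [exact: cvg_cst|exact: cvg_id].
  by apply: cvgM; apply: cV.
- rewrite ge_min le_max; apply/andP; split; apply/orP; [right|left].
    apply: (@le_trans _ _ (\sum_(i : V) (#|V|%:R^-1) ^+ 2 : R)).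
      apply: ler_sum => i _; rewrite lerXn2r// ?nnegrE ?invr_ge0 ?ler0n//.
        by move: (Mi0 i) => ?; lra.
      by rewrite lef_pV2 ?posrE; move: (Mi0 i) => ?; lra.
    rewrite sumr_const -[X in X <= _]mulr_natr expr2 -mulrA mulVf ?mulr1; last by lra.
    by rewrite invf_le1; lra.
  rewrite /f (bigD1 i0) //= subrKC invr1 expr1n lerDl.
  by apply: sumr_ge0 => i _; apply: sqr_ge0.
move: yab; rewrite in_itv /= => /andP[y1 _].
exists (fun i => (M i + y)^-1); split => //.
  by move=> i; rewrite invr_gt0 (lt_le_trans ltr01)// pos.
by exists (- y) => i; rewrite invrK addrC addrK.
Qed.

(* [M i = x + (s i)^-1] is the first-order condition for [p_i = s i ^+ 2] to
   minimize [<p, M> - 2 * sum_i sqrt p_i] over the simplex, which is why the left-hand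
   side bounds the perturbed objective at every unit vector r. *)
Lemma tsallis_step (R : realType) (V : finType) (M m s r : V -> R) x :
  (forall i, 0 < s i) -> (forall i, 0 <= m i) ->
  \sum_i s i ^+ 2 = 1 -> \sum_i r i ^+ 2 = 1 ->
  (forall i, M i = x + (s i)^-1) ->
  \sum_i (s i ^+ 2 * M i - 2 * s i) + \sum_i (s i ^+ 2 * m i - s i ^+ 3 * m i ^+ 2)
  <= \sum_i (r i ^+ 2 * (M i + m i) - 2 * r i).
Proof.
move=> s0 m0 s1 r1 Mx; rewrite -subr_ge0 -big_split -sumrB /=.
(* Substituting [M i = x + (s i)^-1] and completing the square leaves nonnegative terms plus a
   multiple of [x], which vanishes since both vectors are normalised. *)
rewrite (eq_bigr (fun i => x * (r i ^+ 2 - s i ^+ 2) +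
  ((r i - s i + s i ^+ 2 * m i) ^+ 2 + (r i - s i) ^+ 2 * s i * m i) / s i)).
  rewrite big_split /= -mulr_sumr sumrB s1 r1 subrr mulr0 add0r.
  apply: sumr_ge0 => i _; apply: divr_ge0; last exact: ltW.
  by rewrite addr_ge0 ?sqr_ge0// mulr_ge0// mulr_ge0 ?sqr_ge0// ltW.
by move=> i _; rewrite Mx; field; rewrite gt_eqF.
Qed.

(* [z - 1 - ln z >= (sqrt z - 1) ^ 2], followed by AM-GM. *)
Lemma ratio_le_entropy (R : realType) (z : R) : 0 < z ->
  z - 1 <= 1 / 8 + 9 * (z - 1 - ln z).
Proof.
move=> z0; have y0 : 0 < Num.sqrt z by rewrite sqrtr_gt0.
rewrite -{1 2}(sqr_sqrtr (ltW z0)); set y := Num.sqrt z in y0 *.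
have : ln z <= 2 * (y - 1).
  rewrite -(sqr_sqrtr (ltW z0)) -/y expr2 lnM ?posrE//.
  have /le_ln1Dx : -1 < y - 1 by lra.
  by rewrite subrKC => ?; lra.
by have := sqr_ge0 (8 * (y - 1) - 1) => ? ?; nra.
Qed.

(** The left-hand side is twice the relative entropy of a fair coin with respect to one of bias
    [1/2 - e]. It equals [- ln (1 - 4 e^2)], at most [4 e^2 / (1 - 4 e^2)], and [4 e^2 <= 1/4]. *)
Lemma sum_ln_opp_le (R : realType) (e : R) : 0 <= e -> e <= 1 / 4 ->
  - (ln (1 - 2 * e) + ln (1 + 2 * e)) <= 6 * e ^+ 2.
Proof.
move=> e0 e1; rewrite -lnM ?posrE; [|lra|lra].
rewrite (_ : (1 - 2 * e) * (1 + 2 * e) = 1 - 4 * e ^+ 2); last by ring.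
have e2 : e ^+ 2 <= 1 / 16 by nra.
have p0 : 0 < 1 - 4 * e ^+ 2 by lra.
rewrite -lnV ?posrE//.
have /le_ln1Dx : -1 < (1 - 4 * e ^+ 2)^-1 - 1.
  by rewrite -subr_gt0 opprK subrK invr_gt0.
rewrite subrKC => /le_trans; apply.
rewrite lerBlDr -(ler_pM2r p0) mulVf ?gt_eqF//.
by have := sqr_ge0 e => ?; nra.
Qed.

(** * The exploring algorithm *)

Section Play.
Variables (R : realType) (V : finType) (E : rel V).

(** Trajectories record whole loss vectors, so that regret can be written on them; this projection
    keeps only what the player sees. *)
Definition transcript (s : seq ((V -> R) * V)) : history R V :=
  [seq (y.2, feedback E y.1 y.2) | y <- s].

Variables (A : algorithm R V) (T : nat) (L : 'I_T -> V -> R).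

(** [expect] numbers rounds by naturals; the default 0 only fills in beyond the horizon. *)
Definition nat_loss (n : nat) : V -> R :=
  if insub n is Some t then L t else fun=> 0.

Lemma nat_loss_ord (t : 'I_T) : nat_loss t = L t.
Proof. by rewrite /nat_loss valK. Qed.

Definition play_expect : (seq ((V -> R) * V) -> R) -> R :=
  expect (fun n v => (nat_loss n, v)) (fun s v => A (transcript s) v) T.

Lemma play_expectE F :
  \sum_w play_prob E A L w * F [seq (L t, w t) | t : 'I_T <- enum 'I_T] =
  play_expect F.
Proof.
rewrite /play_expect -expectE; apply: eq_bigr => w _.
congr (_ * F _); last by apply: eq_map => t; rewrite nat_loss_ord.
apply: eq_bigr => t _; congr (A _ _); rewrite /past /transcript -map_comp.
by apply: eq_map => s /=; rewrite nat_loss_ord.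
Qed.

Lemma play_prob_sum1 : \sum_w play_prob E A L w = 1.
Proof.
have := play_expectE (fun=> 1).
under eq_bigr do rewrite mulr1.
by move=> ->; apply: expect_cst => s; apply: arm_prob_sum1.
Qed.

Lemma regretE a : regret E A L a =
  \sum_w play_prob E A L w * \sum_(t < T) (L t (w t) - L t a).
Proof.
rewrite /regret /expected_loss -[X in _ - X]mul1r -play_prob_sum1 mulr_suml.
by rewrite -sumrB; apply: eq_bigr => w _; rewrite sumrB mulrBr.
Qed.

Lemma regret_expect a : regret E A L a =
  play_expect (fun s => \sum_(y <- s) (y.1 y.2 - y.1 a)).
Proof.
rewrite regretE -play_expectE; apply: eq_bigr => w _; congr (_ * _).
by rewrite big_map big_enum.
Qed.

End Play.

Section Exploration.
Variables (R : realType) (V : finType) (E : rel V) (v0 : V) (f : V -> V).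
Hypothesis f_observes : forall i, E (f i) i.
Variables (gamma eta : R).
Hypotheses (gamma_gt0 : 0 < gamma) (gamma_le1 : gamma <= 1) (eta_gt0 : 0 < eta).

Definition tsallis_root (M : V -> R) : V -> R := sval (cid (tsallis_exists v0 M)).

Lemma tsallis_root_gt0 M i : 0 < tsallis_root M i.
Proof. by rewrite /tsallis_root; case: cid => s [? ? ?] /=. Qed.

Lemma tsallis_root_sum1 M : \sum_i tsallis_root M i ^+ 2 = 1.
Proof. by rewrite /tsallis_root; case: cid => s [? ? ?] /=. Qed.

Lemma tsallis_rootE M : exists x, forall i, M i = x + (tsallis_root M i)^-1.
Proof. by rewrite /tsallis_root; case: cid => s [? ? ?] /=. Qed.

(** Cauchy-Schwarz, in the AM-GM form [s <= k s^2 / 2 + 1 / (2 k)] with [k^2 = N]. *)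
Lemma tsallis_root_sum_le M : \sum_i tsallis_root M i <= Num.sqrt #|V|%:R.
Proof.
have n0 : (0 : R) < #|V|%:R by rewrite ltr0n; apply/card_gt0P; exists v0.
have k0 : 0 < Num.sqrt #|V|%:R :> R by rewrite sqrtr_gt0.
set k := Num.sqrt _ in k0 *.
have kk : k ^+ 2 = #|V|%:R by rewrite sqr_sqrtr// ltW.
apply: (@le_trans _ _ (\sum_i (k / 2 * tsallis_root M i ^+ 2 + (2 * k)^-1))).
  apply: ler_sum => i _; set s := tsallis_root M i.
  rewrite -subr_ge0 (_ : _ - s = (k * s - 1) ^+ 2 / (2 * k)).
    by rewrite divr_ge0 ?sqr_ge0// mulr_ge0// ltW.
  by field; rewrite gt_eqF.
rewrite big_split /= -mulr_sumr tsallis_root_sum1 sumr_const -[_^-1 *+ _]mulr_natr -kk.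
by rewrite le_eqVlt; apply/orP; left; apply/eqP; field; rewrite gt_eqF.
Qed.

(** The minimum over the simplex of [<p, M> - 2 * sum_i sqrt p_i], attained at
    [p_i = tsallis_root M i ^+ 2]. *)
Definition potential (M : V -> R) : R :=
  \sum_i (tsallis_root M i ^+ 2 * M i - 2 * tsallis_root M i).

Definition explore (M : V -> R) (v : V) : R :=
  (1 - gamma) * tsallis_root M v ^+ 2 +
  gamma * \sum_i tsallis_root M i ^+ 2 * (v == f i)%:R.

Definition obs_prob (M : V -> R) (i : V) : R := \sum_(u | E u i) explore M u.

Lemma explore_sum M (g : V -> R) : \sum_v explore M v * g v =
  (1 - gamma) * \sum_v tsallis_root M v ^+ 2 * g v +
  gamma * \sum_v tsallis_root M v ^+ 2 * g (f v).
Proof.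
rewrite (eq_bigr (fun v => (1 - gamma) * (tsallis_root M v ^+ 2 * g v) + gamma *
  \sum_i tsallis_root M i ^+ 2 * (v == f i)%:R * g v)); last first.
  by move=> v _; rewrite /explore -mulr_suml; ring.
rewrite big_split /= -!mulr_sumr exchange_big /=; congr (_ + _ * _).
apply: eq_bigr => i _; rewrite (bigD1 (f i)) //= eqxx mulr1 big1 ?addr0//.
by move=> v /negbTE ->; rewrite mulr0 mul0r.
Qed.

Lemma explore_ge0 M v : 0 <= explore M v.
Proof.
rewrite addr_ge0// mulr_ge0 ?sqr_ge0 ?subr_ge0// ?(ltW gamma_gt0)//.
by apply: sumr_ge0 => i _; rewrite mulr_ge0 ?sqr_ge0.
Qed.

Lemma explore_sum1 M : \sum_v explore M v = 1.
Proof.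
under eq_bigr do rewrite -[explore _ _]mulr1.
rewrite explore_sum; under eq_bigr do rewrite mulr1.
by rewrite tsallis_root_sum1; ring.
Qed.

Lemma obs_prob_ge M i : gamma * tsallis_root M i ^+ 2 <= obs_prob M i.
Proof.
rewrite /obs_prob (bigD1 (f i)) ?f_observes //=.
apply: (@le_trans _ _ (explore M (f i))); last first.
  by rewrite lerDl; apply: sumr_ge0 => u _; apply: explore_ge0.
rewrite -[leLHS]add0r; apply: lerD; first by rewrite mulr_ge0 ?sqr_ge0 ?subr_ge0.
rewrite ler_wpM2l ?(ltW gamma_gt0)// (bigD1 i) //= eqxx mulr1 lerDl.
by apply: sumr_ge0 => u _; rewrite mulr_ge0 ?sqr_ge0.
Qed.

Lemma obs_prob_gt0 M i : 0 < obs_prob M i.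
Proof.
by apply: lt_le_trans (obs_prob_ge M i); rewrite mulr_gt0// exprn_gt0// tsallis_root_gt0.
Qed.

Lemma potential_step M (m : V -> R) : (forall i, 0 <= m i) ->
  potential M + \sum_i (tsallis_root M i ^+ 2 * m i - tsallis_root M i ^+ 3 * m i ^+ 2)
  <= potential (fun i => M i + m i).
Proof.
move=> m0; have [x Mx] := tsallis_rootE M.
exact: tsallis_step (tsallis_root_gt0 M) m0 (tsallis_root_sum1 _)
  (tsallis_root_sum1 _) Mx.
Qed.

(** Compare the minimiser with the point mass at [a], whose objective value is [M a - 2]. *)
Lemma potential_le M a : potential M <= M a.
Proof.
have [x Mx] := tsallis_rootE M.
have r1 : \sum_i (i == a)%:R ^+ 2 = 1 :> R.
  by rewrite (bigD1 a) //= eqxx expr1n big1 ?addr0// => i /negbTE ->; rewrite expr0n.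
have := @tsallis_step R V M (fun=> 0) _ _ x (tsallis_root_gt0 M)
  (fun=> lexx 0) (tsallis_root_sum1 M) r1 Mx.
rewrite [X in _ + X]big1; last by move=> i _; rewrite expr0n /= !mulr0 subrr.
rewrite addr0 => /le_trans; apply.
rewrite (bigD1 a) //= eqxx big1; last first.
  by move=> i /negbTE ->; rewrite expr0n /= mul0r mulr0 subrr.
by rewrite expr1n mulr1 mul1r !addr0 gerBl.
Qed.

(** Dividing by the observation probability makes this an unbiased estimate of [eta * l i]. *)
Definition increment (M l : V -> R) (v i : V) : R :=
  eta * (if E v i then l i / obs_prob M i else 0).

Lemma increment_mean M l i : \sum_v explore M v * increment M l v i = eta * l i.
Proof.
rewrite (eq_bigr (fun v => if E v i then explore M v * (eta * (l i / obs_prob M i)) else 0)).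
  rewrite -big_mkcond -mulr_suml -/(obs_prob M i).
  by field; rewrite gt_eqF// obs_prob_gt0.
by move=> v _; rewrite /increment; case: ifP => _; rewrite ?mulr0.
Qed.

Lemma increment_sqr_mean M l i : \sum_v explore M v * increment M l v i ^+ 2 =
  eta ^+ 2 * l i ^+ 2 / obs_prob M i.
Proof.
rewrite (eq_bigr (fun v =>
  if E v i then explore M v * (eta * (l i / obs_prob M i)) ^+ 2 else 0)).
  rewrite -big_mkcond -mulr_suml -/(obs_prob M i).
  by field; rewrite gt_eqF// obs_prob_gt0.
by move=> v _; rewrite /increment; case: ifP => _; rewrite ?mulr0 ?expr0n ?mulr0.
Qed.

Lemma explore_loss_le M (l : V -> R) : (forall v, 0 <= l v <= 1) ->
  \sum_v explore M v * l v <= \sum_v tsallis_root M v ^+ 2 * l v + gamma.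
Proof.
move=> l01; rewrite explore_sum mulrBl mul1r -addrA lerD2l addrC -mulrBr -[leRHS]mulr1.
rewrite ler_wpM2l ?(ltW gamma_gt0)// lerBlDr -(tsallis_root_sum1 M) -[leLHS]addr0.
apply: lerD; last first.
  by apply: sumr_ge0 => v _; rewrite mulr_ge0 ?sqr_ge0//; case/andP: (l01 v).
apply: ler_sum => v _; rewrite ler_piMr ?sqr_ge0//.
by case/andP: (l01 (f v)).
Qed.

(** After [potential_step], unbiasedness makes the first-order terms cancel the regret of the
    distribution [s i ^+ 2]; what remains is [gamma] for exploration and a second-moment term of the
    estimates. *)
Lemma explore_drift M (l : V -> R) a : (forall v, 0 <= l v <= 1) ->
  \sum_v explore M v * (l v - l a + (M a + increment M l v a -
    potential (fun i => M i + increment M l v i)) / eta)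
  <= (M a - potential M) / eta + (gamma + eta / gamma * Num.sqrt #|V|%:R).
Proof.
move=> l01; set s := tsallis_root M.
have m0 v i : 0 <= increment M l v i.
  rewrite /increment mulr_ge0 ?(ltW eta_gt0)//; case: ifP => // _.
  by rewrite divr_ge0 ?(ltW (obs_prob_gt0 _ _))//; case/andP: (l01 i).
apply: (@le_trans _ _ (\sum_v (explore M v * l v
  + explore M v * ((M a - potential M) / eta - l a)
  + (explore M v * increment M l v a) / eta
  - \sum_i (s i ^+ 2 / eta * (explore M v * increment M l v i)
            - s i ^+ 3 / eta * (explore M v * increment M l v i ^+ 2))))).
  apply: ler_sum => v _.
  rewrite [leRHS](_ : _ = explore M v * (l v - l a + (M a + increment M l v a -
    (potential M + \sum_i (s i ^+ 2 * increment M l v i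
                           - s i ^+ 3 * increment M l v i ^+ 2))) / eta)).
    rewrite ler_wpM2l ?explore_ge0// lerD2l ler_pM2r ?invr_gt0// lerD2l lerN2.
    exact: potential_step.
  rewrite (eq_bigr (fun i => explore M v / eta * (s i ^+ 2 * increment M l v i
                           - s i ^+ 3 * increment M l v i ^+ 2))).
    by rewrite -mulr_sumr; field; rewrite gt_eqF.
  by move=> i _; field; rewrite gt_eqF.
rewrite sumrB !big_split /= -!mulr_suml explore_sum1 mul1r increment_mean.
rewrite exchange_big /=.
rewrite [X in _ - X](eq_bigr (fun i => s i ^+ 2 * l i
   - eta * (s i ^+ 3 * l i ^+ 2 / obs_prob M i))); last first.
  move=> i _; rewrite sumrB -!mulr_sumr increment_mean increment_sqr_mean.
  by field; rewrite !gt_eqF// obs_prob_gt0.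
rewrite sumrB -mulr_sumr.
have := explore_loss_le M l01; rewrite -/s.
(* [obs_prob_ge] trades [1 / obs_prob] for [1 / (gamma * s i ^+ 2)], so one of the three powers of
   [s] survives. *)
have bnd : \sum_i s i ^+ 3 * l i ^+ 2 / obs_prob M i <= Num.sqrt #|V|%:R / gamma.
  apply: (@le_trans _ _ (\sum_i s i / gamma)); last first.
    by rewrite -mulr_suml ler_pM2r ?invr_gt0// tsallis_root_sum_le.
  apply: ler_sum => i _; have s0 : 0 < s i := tsallis_root_gt0 M i.
  have /andP[l0 l1] := l01 i.
  rewrite ler_pdivrMr ?obs_prob_gt0//.
  apply: (@le_trans _ _ (s i ^+ 3)).
    by rewrite ler_piMr ?exprn_ge0 ?(ltW s0)// expr_le1.
  rewrite -mulrA exprS ler_pM2l// mulrC ler_pdivlMr// mulrC.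
  exact: obs_prob_ge.
have : eta * (\sum_i s i ^+ 3 * l i ^+ 2 / obs_prob M i) <=
  eta / gamma * Num.sqrt #|V|%:R.
  by rewrite -mulrA ler_pM2l// mulrC.
rewrite [eta * l a / eta]mulrAC mulfV ?gt_eqF// mul1r.
by move=> ? ?; lra.
Qed.

(** Each estimate divides by a probability computed from earlier rounds, so the recursion runs back
    from the newest round; histories list the oldest first, hence the reversal in [estimate]. *)
Fixpoint estimate_rev (h : history R V) : V -> R :=
  if h is (_, o) :: h' then
    fun i => estimate_rev h' i +
      eta * (if o i is Some y then y / obs_prob (estimate_rev h') i else 0)
  else fun=> 0.

Definition estimate (h : history R V) := estimate_rev (rev h).

Lemma estimate_rcons h l v : estimate (rcons h (v, feedback E l v)) =
  fun i => estimate h i + increment (estimate h) l v i.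
Proof.
apply/funext => i; rewrite /estimate rev_rcons /= /increment ffunE inE.
by case: ifP.
Qed.

Definition explore_alg : algorithm R V :=
  Algorithm (fun h => explore_ge0 (estimate h)) (fun h => explore_sum1 (estimate h)).

(* The regret so far plus the gap [(M a - potential M) / eta], which is never
   negative, drifts by at most the bracketed amount in each round. *)
Lemma explore_alg_regret T (L : 'I_T -> V -> R) a : loss_sequence L ->
  regret E explore_alg L a <= 2 * Num.sqrt #|V|%:R / eta +
    (gamma + eta / gamma * Num.sqrt #|V|%:R) * T%:R.
Proof.
move=> L01; rewrite regret_expect /play_expect.
pose Psi (s : seq ((V -> R) * V)) := \sum_(y <- s) (y.1 y.2 - y.1 a) +
  (estimate (transcript E s) a - potential (estimate (transcript E s))) / eta.
apply: (@le_trans _ _ (play_expect E explore_alg L Psi)).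
  apply: le_expect => [s x|s _]; first exact: arm_prob_ge0.
  by rewrite lerDl divr_ge0 ?(ltW eta_gt0)// subr_ge0 potential_le.
apply: le_trans (expect_drift (b := gamma + eta / gamma * Num.sqrt #|V|%:R) _ _ _) _.
- by move=> s x; apply: arm_prob_ge0.
- by move=> s; apply: arm_prob_sum1.
- move=> m s mT /=; set l := nat_loss L m.
  have l01 v : 0 <= l v <= 1.
    by rewrite /l -[m]/(nat_of_ord (Ordinal mT)) nat_loss_ord.
  set M := estimate (transcript E s).
  have := explore_drift M a l01.
  set S := \sum_(y <- s) (y.1 y.2 - y.1 a).
  rewrite -(lerD2l S) addrA => /(le_trans _); apply.
  rewrite -[X in _ <= X + _]mul1r -(explore_sum1 M) mulr_suml -big_split /=.
  apply: ler_sum => v _; rewrite -mulrDr /Psi big_rcons /= /transcript map_rcons /=.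
  rewrite estimate_rcons -/M -/S le_eqVlt; apply/orP; left; apply/eqP.
  by rewrite /=; ring.
(* Before the first round the estimates vanish, and the gap is [2 / eta] times the sum of the
   roots. *)
rewrite lerD2r /Psi big_nil add0r ler_pM2r ?invr_gt0//.
rewrite /estimate /= sub0r /potential -sumrN.
rewrite (eq_bigr (fun i => 2 * tsallis_root (fun=> 0) i)).
  by rewrite -mulr_sumr ler_pM2l// tsallis_root_sum_le.
by move=> i _; rewrite mulr0 sub0r opprK.
Qed.

End Exploration.

(** * Fractional powers and the choice of parameters *)

Lemma powR_fraction (R : realType) (x : R) (p q : nat) :
  0 <= x -> (0 < q)%N -> x `^ (p%:R / q%:R) = (x `^ (1 / q%:R)) ^+ p.
Proof. by move=> x0 q0; rewrite -powR_mulrn ?powR_ge0// -powRrM mul1r mulrC. Qed.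

Lemma powR_root (R : realType) (x : R) (q : nat) :
  0 <= x -> (0 < q)%N -> (x `^ (1 / q%:R)) ^+ q = x.
Proof.
by move=> x0 q0; rewrite -powR_fraction// mulfV ?pnatr_eq0 -?lt0n// powRr1.
Qed.

Lemma minimax_regret_le (R : realType) (V : finType) (E : rel V) (T : nat) :
  symmetric E -> (0 < #|V|)%N -> (forall v, exists u, E v u) -> (#|V| <= T)%N ->
  (minimax_regret R E T <= (4 * #|V|%:R `^ (1 / 3) * T%:R `^ (2 / 3))%:E)%E.
Proof.
move=> symE V0 nbr VT; have /card_gt0P[v0 _] := V0.
have T0 : (0 < T)%N := leq_trans V0 VT.
(* With sixth roots of N and T every exponent becomes an integer, including that of
   [sqrt N = al^3]. *)
pose f i := xchoose (nbr i).
have fE i : E (f i) i by rewrite symE; apply: xchooseP (nbr i).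
pose al : R := #|V|%:R `^ (1 / 6); pose be : R := T%:R `^ (1 / 6).
have al0 : 0 < al by rewrite powR_gt0// ltr0n.
have be0 : 0 < be by rewrite powR_gt0// ltr0n.
have al6 : al ^+ 6 = #|V|%:R by rewrite powR_root.
have be6 : be ^+ 6 = T%:R by rewrite powR_root.
have albe : al <= be by rewrite ge0_ler_powR ?nnegrE ?ler_nat ?divr_ge0.
have -> : #|V|%:R `^ (1 / 3) = al ^+ 2 :> R.
  by rewrite -powR_fraction//; congr (_ `^ _); field.
have -> : T%:R `^ (2 / 3) = be ^+ 4 :> R.
  by rewrite -powR_fraction//; congr (_ `^ _); field.
(* The term [2 sqrt N / eta] becomes [2 al^2 be^4], and the two per-round terms, summed over T
   rounds, give [al^2 be^4] each: hence the constant 4. *)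
pose gamma := al ^+ 2 / be ^+ 2; pose eta := al / be ^+ 4.
have gamma0 : 0 < gamma by rewrite divr_gt0 ?exprn_gt0.
have gamma1 : gamma <= 1.
  by rewrite ler_pdivrMr ?exprn_gt0// mul1r lerXn2r// nnegrE ltW.
have eta0 : 0 < eta by rewrite divr_gt0 ?exprn_gt0.
apply: ge_ereal_inf; exists (worst_regret E T (explore_alg E v0 f eta gamma0 gamma1)).
  by exists (explore_alg E v0 f eta gamma0 gamma1).
apply: ge_ereal_sup => _ [L [a [L01 _ ->]]]; rewrite lee_fin.
apply: le_trans (explore_alg_regret v0 fE gamma0 gamma1 eta0 a L01) _.
have -> : Num.sqrt #|V|%:R = al ^+ 3.
  by rewrite -al6 (exprM al 3 2) sqrtr_sqr ger0_norm// exprn_ge0// ltW.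
rewrite -be6 /gamma /eta le_eqVlt; apply/orP; left; apply/eqP.
by field; rewrite !gt_eqF.
Qed.

(** * Lower bound *)

(* A maximal independent set is dominating, so it has at least |V| / (d + 1)
   elements; extending a non-adjacent pair keeps it from being a singleton. *)
Lemma exists_large_independent (V : finType) (E : rel V) (d : nat) :
  undirected E -> (forall v, #|N_out E v| <= d)%N ->
  (exists u v, u != v /\ ~~ E u v) ->
  exists I : {set V}, [/\ {in I &, forall u v, ~~ E u v}, (1 < #|I|)%N &
    (#|V| <= #|I| * d.+1)%N].
Proof.
move=> [symE irrE] degE [u [v [uv nE]]].
pose indep (I : {set V}) := [forall x in I, forall y in I, ~~ E x y].
have indep_uv : indep [set u; v]%SET.
  apply/forall_inP => x /set2P xuv; apply/forall_inP => y /set2P yuv.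
  by case: xuv => ->; case: yuv => ->; rewrite ?irrE // symE.
have [I /maxsetP[indepI maxI] uvI] := maxset_exists indep_uv.
have indI : {in I &, forall x y, ~~ E x y}.
  by move=> x y xI yI; move: indepI => /forall_inP/(_ x xI)/forall_inP/(_ y yI).
exists I; split => //.
  by apply: leq_trans (subset_leq_card uvI); rewrite cards2 uv.
have cover : [set: V]%SET \subset (\bigcup_(x in I) (x |: N_out E x))%SET.
  apply/fintype.subsetP => y _; apply/finset.bigcupP.
  have [yI|yI] := boolP (y \in I); first by exists y => //; rewrite in_setU1 eqxx.
  have [/exists_inP[x xI Exy]|] := boolP [exists x in I, E x y].
    by exists x => //; rewrite in_setU1 inE Exy orbT.
  rewrite negb_exists => /forallP nEy; case/negP: yI.
  have nE' x : x \in I -> ~~ E x y by move=> xI; have := nEy x; rewrite xI.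
  rewrite -(maxI (y |: I)%SET) ?setU11 ?finset.subsetUr//.
  apply/forall_inP => x; rewrite in_setU1 => xyI.
  apply/forall_inP => z; rewrite in_setU1 => zyI.
  case/orP: xyI => [/eqP->|xI]; case/orP: zyI => [/eqP->|zI].
  - by rewrite irrE.
  - by rewrite symE nE'.
  - by rewrite nE'.
  - exact: indI.
rewrite -cardsT; apply: leq_trans (subset_leq_card cover) _.
apply: (@leq_trans (\sum_(x in I) #|(x |: N_out E x)%SET|)).
  elim/big_ind2: _ => [|A m B n Am Bn|//]; first by rewrite cards0.
  by rewrite (leq_trans _ (leq_add Am Bn)) ?leq_card_setU.
rewrite -sum_nat_const; apply: leq_sum => x _.
by rewrite cardsU1 -add1n leq_add// leq_b1.
Qed.

Section LowerBound.
Variables (R : realType) (V : finType) (E : rel V) (I : {set V}).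
Variables (A : algorithm R V).

Local Notation coins := {ffun V -> bool}.

Definition coin_loss (w : coins) (v : V) : R :=
  if v \in I then (w v)%:R else 1.

Definition coin_history (s : seq (coins * V)) : history R V :=
  [seq (y.2, feedback E (coin_loss y.1) y.2) | y <- s].

Definition avg (g : coins -> R) : R := #|{: coins}|%:R^-1 * \sum_w g w.

(** [mu] is a density relative to fair coins: [fun=> 1] is the null model, [tilt eps i] the
    alternative. Coins are fresh each round and independent of the arm played. *)
Definition coin_kernel (mu : coins -> R) (s : seq (coins * V)) (y : coins * V) : R :=
  #|{: coins}|%:R^-1 * mu y.1 * A (coin_history s) y.2.

Local Notation Ex mu := (expect (fun=> id) (coin_kernel mu)).

Lemma coin_kernel_sum mu s g : \sum_y coin_kernel mu s y * g y =
  \sum_v A (coin_history s) v * avg (fun w => mu w * g (w, v)).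
Proof.
under [RHS]eq_bigr do rewrite /avg mulrCA mulr_sumr mulr_sumr.
rewrite exchange_big pair_big /=; apply: eq_bigr => -[w v] _ /=.
by rewrite /coin_kernel /=; ring.
Qed.

Lemma avg_cst c : avg (fun=> c) = c.
Proof.
rewrite /avg sumr_const -[c *+ _]mulr_natl mulrA mulVf ?mul1r// pnatr_eq0 -lt0n.
by apply/card_gt0P; exists [ffun=> true].
Qed.

Definition flip (i : V) (w : coins) : coins :=
  [ffun v => if v == i then ~~ w v else w v].

Lemma flipK i : involutive (flip i).
Proof.
by move=> w; apply/ffunP => v; rewrite !ffunE; case: eqP => // _; rewrite negbK.
Qed.

(** Flipping coin [i] preserves the uniform law; pairing each outcome with its flip reduces the
    averages below to cases on one or two coins. *)
Lemma avg_flip i g : avg g = avg (fun w => (g w + g (flip i w)) / 2).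
Proof.
rewrite /avg; congr (_ * _); rewrite -mulr_suml big_split /=.
rewrite -(reindex_inj (h := flip i) (P := predT) (F := g)) /=; first by field.
exact: inv_inj (flipK i).
Qed.

Lemma eq_avg g h : g =1 h -> avg g = avg h.
Proof. by move=> gh; rewrite /avg; congr (_ * _); apply: eq_bigr. Qed.

Lemma avgZ c g : avg (fun w => c * g w) = c * avg g.
Proof. by rewrite /avg -mulr_sumr mulrCA. Qed.

(** The density that makes coin [i] show 1 with probability [1/2 - eps] and keeps the others
    fair. *)
Definition tilt (eps : R) (i : V) (w : coins) : R :=
  if w i then 1 - 2 * eps else 1 + 2 * eps.

Lemma avg_tilt eps i (g : coins -> R) : (forall w, g (flip i w) = g w) ->
  avg (fun w => tilt eps i w * g w) = avg g.
Proof.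
move=> gi; rewrite (avg_flip i); apply: eq_avg => w; rewrite gi /tilt ffunE eqxx.
by case: (w i) => /=; field.
Qed.

Lemma avg_tilt1 eps i : avg (tilt eps i) = 1.
Proof.
rewrite -[RHS](avg_cst 1) -(avg_tilt eps (i := i) (g := fun=> 1))//.
by apply: eq_avg => w; rewrite mulr1.
Qed.

Lemma avg_coin_gap i v : i \in I ->
  avg (fun w => 1 * (coin_loss w v - coin_loss w i)) = (v \notin I)%:R / 2.
Proof.
move=> iI; rewrite (avg_flip i).
have [vI|vI] /= := boolP (v \in I).
  rewrite (avg_flip v) -[RHS](avg_cst (0 / 2)); apply: eq_avg => w.
  rewrite /coin_loss iI vI !ffunE !eqxx; case: (altP (v =P i)) => [->|vi].
    by rewrite eqxx; case: (w i) => /=; field.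
  by rewrite eq_sym (negbTE vi); case: (w i); case: (w v) => /=; field.
rewrite -[RHS](avg_cst (1 / 2)); apply: eq_avg => w.
rewrite /coin_loss iI (negbTE vI) ffunE eqxx.
by case: (w i) => /=; field.
Qed.

Lemma avg_tilt_gap eps i v : 0 <= eps -> i \in I ->
  eps * (v != i)%:R <= avg (fun w => tilt eps i w * (coin_loss w v - coin_loss w i)).
Proof.
move=> e0 iI; case: (altP (v =P i)) => [->|vi] /=.
  rewrite mulr0 -{1}(avg_cst 0) le_eqVlt; apply/orP; left; apply/eqP.
  by apply: eq_avg => w; rewrite subrr mulr0.
rewrite mulr1 (avg_flip i); have [vI|vI] := boolP (v \in I).
  rewrite (avg_flip v) -{1}(avg_cst eps) le_eqVlt; apply/orP; left; apply/eqP.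
  apply: eq_avg => w; rewrite /coin_loss /tilt iI vI !ffunE !eqxx [i == v]eq_sym.
  by rewrite (negbTE vi); case: (w i); case: (w v) => /=; field.
rewrite (@eq_avg _ (fun=> 1 / 2 + eps)) ?avg_cst; first by lra.
move=> w; rewrite /coin_loss /tilt iI (negbTE vI) ffunE eqxx.
by case: (w i) => /=; field.
Qed.

Section Kernel.
Variable mu : coins -> R.
Hypotheses (mu_ge0 : forall w, 0 <= mu w) (mu_avg1 : avg mu = 1).

Lemma coin_kernel_ge0 s y : 0 <= coin_kernel mu s y.
Proof. by rewrite !mulr_ge0 ?invr_ge0 ?arm_prob_ge0. Qed.

Lemma coin_kernel_sum1 s : \sum_y coin_kernel mu s y = 1.
Proof.
under eq_bigr do rewrite -[coin_kernel _ _ _]mulr1.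
rewrite coin_kernel_sum -[RHS](arm_prob_sum1 A (coin_history s)).
apply: eq_bigr => v _; rewrite (@eq_avg _ mu) ?mu_avg1 ?mulr1// => w.
by rewrite mulr1.
Qed.

Lemma coin_expectE T F :
  \sum_(w : {ffun 'I_T -> coins}) (\prod_(t < T) (#|{: coins}|%:R^-1 * mu (w t))) *
    \sum_(a : {ffun 'I_T -> V}) play_prob E A (fun t => coin_loss (w t)) a *
      F [seq (w t, a t) | t : 'I_T <- enum 'I_T] = Ex mu T F.
Proof.
rewrite -expectE; under eq_bigr do rewrite mulr_sumr.
rewrite pair_big /=.
pose zipf (p : {ffun 'I_T -> coins} * {ffun 'I_T -> V}) :
  {ffun 'I_T -> coins * V} := [ffun t => (p.1 t, p.2 t)].
rewrite [RHS](reindex zipf) /=.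
  apply: eq_bigr => -[w a] _ /=.
  have pre (r : seq 'I_T) : [seq zipf (w, a) s | s <- r] = [seq (w s, a s) | s <- r].
    by apply: eq_map => s; rewrite ffunE.
  rewrite mulrA pre; congr (_ * _); rewrite /play_prob -big_split /=.
  apply: eq_bigr => t _; rewrite /coin_kernel ffunE /= pre; congr (_ * A _ _).
  by rewrite /past /coin_history -map_comp.
exists (fun x => ([ffun t => (x t).1], [ffun t => (x t).2])).
  by move=> [w a] _; congr pair; apply/ffunP => t; rewrite !ffunE.
by move=> x _; apply/ffunP => t; rewrite !ffunE -surjective_pairing.
Qed.

(** Random coins are a mixture of fixed loss sequences, each of which obeys the regret bound. *)
Lemma coin_regret_le T x i :
  (forall L a, loss_sequence L -> regret E A (L : 'I_T -> V -> R) a <= x) ->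
  Ex mu T (fun s => \sum_(y <- s) (coin_loss y.1 y.2 - coin_loss y.1 i)) <= x.
Proof.
move=> regx.
rewrite -[leRHS](expect_cst (fun=> id) coin_kernel_sum1 T x) -!coin_expectE.
apply: ler_sum => w _; apply: ler_wpM2l.
  by apply: prodr_ge0 => t _; rewrite mulr_ge0 ?invr_ge0.
rewrite -mulr_suml play_prob_sum1 mul1r.
apply: le_trans (regx (fun t => coin_loss (w t)) i _); last first.
  move=> t v; rewrite /coin_loss; case: ifP => _; last by rewrite ler01 lexx.
  by rewrite ler0n lern1 leq_b1.
by rewrite regretE; apply: ler_sum => a _; rewrite big_map big_enum.
Qed.

End Kernel.

(** * Change of measure for a single arm *)

Section Arm.
Variables (eps : R) (i : V).
Hypotheses (eps_gt0 : 0 < eps) (eps_le : eps <= 1 / 4) (iI : i \in I).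

Lemma tilt_gt0 w : 0 < tilt eps i w.
Proof.
by move: eps_gt0 eps_le => ? ?; rewrite /tilt; case: ifP => _; lra.
Qed.

Definition step_ratio (y : coins * V) : R := if E y.2 i then tilt eps i y.1 else 1.

Definition likelihood_ratio (s : seq (coins * V)) : R := \prod_(y <- s) step_ratio y.

Lemma step_ratio_gt0 y : 0 < step_ratio y.
Proof. by rewrite /step_ratio; case: ifP => // _; apply: tilt_gt0. Qed.

Lemma likelihood_ratio_gt0 s : 0 < likelihood_ratio s.
Proof. by apply: prodr_gt0 => y _; apply: step_ratio_gt0. Qed.

Lemma ln_likelihood_ratio s :
  ln (likelihood_ratio s) = \sum_(y <- s) ln (step_ratio y).
Proof.
elim: s => [|y s IHs]; first by rewrite /likelihood_ratio !big_nil ln1.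
rewrite /likelihood_ratio !big_cons lnM ?posrE ?step_ratio_gt0 -?IHs//.
exact: likelihood_ratio_gt0.
Qed.

Lemma feedback_flip w v : ~~ E v i ->
  feedback E (coin_loss (flip i w)) v = feedback E (coin_loss w) v.
Proof.
move=> nE; apply/ffunP => u; rewrite !ffunE inE; case: ifP => // Evu.
congr Some; rewrite /coin_loss ffunE; case: eqP => // ui.
by rewrite -ui Evu in nE.
Qed.

(* Only observed coins enter the likelihood ratio: the tilt of a coin that the
   learner does not see averages out. *)
Lemma change_of_measure n (phi : history R V -> R) :
  Ex (tilt eps i) n (phi \o coin_history) =
  Ex (fun=> 1) n (fun s => likelihood_ratio s * phi (coin_history s)).
Proof.
elim: n phi => [|n IHn] phi /=; first by rewrite /likelihood_ratio big_nil mul1r.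
pose psi h := \sum_v A h v * avg (fun w => tilt eps i w *
  phi (rcons h (v, feedback E (coin_loss w) v))).
rewrite [LHS](@eq_expect _ _ _ _ _ n _ (psi \o coin_history)).
  rewrite IHn; apply: eq_expect => s _.
  rewrite coin_kernel_sum /psi mulr_sumr; apply: eq_bigr => v _.
  rewrite mulrCA; congr (_ * _).
  rewrite [RHS](@eq_avg _ (fun w => likelihood_ratio s * (step_ratio (w, v) *
     phi (rcons (coin_history s) (v, feedback E (coin_loss w) v))))); last first.
    move=> w; rewrite /likelihood_ratio big_rcons /= /coin_history map_rcons /=.
    by rewrite mul1r mulrA [X in X * _]mulrC mulrC.
  rewrite avgZ; congr (_ * _).
  rewrite /step_ratio /=; have [//|nE] := boolP (E v i).
  rewrite (avg_tilt eps (i := i)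
    (g := fun w => phi (rcons (coin_history s) (v, feedback E (coin_loss w) v)))).
    by apply: eq_avg => w; rewrite mul1r.
  by move=> w; rewrite feedback_flip.
move=> s _; rewrite coin_kernel_sum /psi /=; apply: eq_bigr => v _.
by congr (_ * _); apply: eq_avg => w; rewrite /coin_history map_rcons.
Qed.

Definition plays (s : seq (coins * V)) : R := \sum_(y <- s) (y.2 == i)%:R.
Definition observations (s : seq (coins * V)) : R := \sum_(y <- s) (E y.2 i)%:R.

Lemma plays_le T s : size s = T -> plays s <= T%:R.
Proof.
move=> <-; rewrite /plays -sum1_size natr_sum; apply: ler_sum => y _.
by rewrite ler_nat leq_b1.
Qed.

(** Chain rule for relative entropy, of the null transcript law with respect to the tilted one: only
    rounds that reveal [i] contribute, each at most [3 * eps ^+ 2]. *)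
Lemma entropy_le T : Ex (fun=> 1) T (fun s => - ln (likelihood_ratio s)) <=
  3 * eps ^+ 2 * Ex (fun=> 1) T observations.
Proof.
rewrite -expectZ.
rewrite [leLHS](@eq_expect _ _ _ _ _ T _ (fun s => \sum_(y <- s) - ln (step_ratio y))).
  rewrite [leRHS](@eq_expect _ _ _ _ _ T _
    (fun s => \sum_(y <- s) 3 * eps ^+ 2 * (E y.2 i)%:R)).
    apply: expect_additive_le => [s y|s|s].
    - exact: coin_kernel_ge0.
    - by apply: coin_kernel_sum1; apply: avg_cst.
    rewrite !coin_kernel_sum; apply: ler_sum => v _.
    apply: ler_wpM2l; first exact: arm_prob_ge0.
    rewrite (avg_flip i) [leRHS](@eq_avg _ (fun=> 3 * eps ^+ 2 * (E v i)%:R)); last first.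
      by move=> w; rewrite mul1r.
    rewrite avg_cst (@eq_avg _ (fun=> if E v i then
      - (ln (1 - 2 * eps) + ln (1 + 2 * eps)) / 2 else 0)).
      rewrite avg_cst; case: ifP => _; rewrite ?mulr0// mulr1.
      by have := sum_ln_opp_le (ltW eps_gt0) eps_le => ?; lra.
    move=> w; rewrite /step_ratio /=; case: ifP => _; last by rewrite ln1; field.
    by rewrite /tilt ffunE eqxx; case: (w i) => /=; field.
  by move=> s _; rewrite /observations mulr_sumr.
by move=> s _; rewrite ln_likelihood_ratio sumrN.
Qed.

(** Under the tilt, regret at most [x] forces [i] to be played in all but [x / eps] rounds on
    average; unless [i] is observed often, it must then be played often under fair coins too. *)
Lemma arm_lower_bound T x :
  (forall L a, loss_sequence L -> regret E A (L : 'I_T -> V -> R) a <= x) ->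
  T%:R <= x / eps + Ex (fun=> 1) T plays + T%:R / 8 +
    27 * T%:R * eps ^+ 2 * Ex (fun=> 1) T observations.
Proof.
move=> regx.
have tilt_ge0 w := ltW (tilt_gt0 w).
have K1 := coin_kernel_sum1 (avg_tilt1 eps i).
have Ki : eps * (T%:R - Ex (tilt eps i) T plays) <= x.
  apply: le_trans (coin_regret_le tilt_ge0 (avg_tilt1 eps i) i regx).
  rewrite -[X in X - _](expect_cst (fun=> id) K1 T) -mulN1r -expectZ -expectD -expectZ.
  rewrite [leLHS](@eq_expect _ _ _ _ _ T _
    (fun s => \sum_(y <- s) eps * (y.2 != i)%:R)).
    apply: expect_additive_le => [s y|s|s].
    - exact: coin_kernel_ge0.
    - exact: K1.
    rewrite !coin_kernel_sum; apply: ler_sum => v _.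
    apply: ler_wpM2l; first exact: arm_prob_ge0.
    apply: le_trans (avg_tilt_gap v (ltW eps_gt0) iI).
    rewrite avg_tilt //= ?avg_cst//.
  move=> s sT; rewrite -mulr_sumr mulN1r /plays -sT -sum1_size natr_sum -sumrB.
  by congr (_ * _); apply: eq_bigr => y _; case: (y.2 == i); rewrite ?subrr ?subr0.
(* [ratio_le_entropy] gives [(Z - 1) * n <= T * (1/8 + 9 * (Z - 1 - ln Z))] for the ratio [Z] and
   the number [n <= T] of plays; under fair coins [Z] has mean 1. *)
have Ei : Ex (tilt eps i) T plays <= Ex (fun=> 1) T plays + T%:R *
    (1 / 8 + 9 * Ex (fun=> 1) T (fun s => - ln (likelihood_ratio s))).
  have Z1 : Ex (fun=> 1) T likelihood_ratio = 1.
    rewrite -[RHS](expect_cst (fun=> id) K1 T).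
    rewrite [RHS](change_of_measure T (fun=> 1)).
    by apply: eq_expect => s _; rewrite mulr1.
  have K0 := coin_kernel_sum1 (avg_cst 1).
  pose phi (h : history R V) : R := \sum_(p <- h) (p.1 == i)%:R.
  have -> : Ex (tilt eps i) T plays = Ex (tilt eps i) T (phi \o coin_history).
    by apply: eq_expect => s _; rewrite /phi /= big_map.
  rewrite change_of_measure.
  have -> : 1 / 8 + 9 * Ex (fun=> 1) T (fun s => - ln (likelihood_ratio s)) =
      Ex (fun=> 1) T (fun s => (1 / 8 - 9) + 9 * (likelihood_ratio s +
        - ln (likelihood_ratio s))).
    by rewrite expectD expectZ expectD Z1 (expect_cst _ K0); ring.
  rewrite -expectZ -expectD; apply: le_expect => [s y|s sT].
    exact: coin_kernel_ge0.
  have -> : phi (coin_history s) = plays s by rewrite /phi big_map.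
  have := ratio_le_entropy (likelihood_ratio_gt0 s).
  have := plays_le sT; have : 0 <= plays s by apply: sumr_ge0.
  have := @le_ln1Dx R (likelihood_ratio s - 1).
  have Zs := likelihood_ratio_gt0 s.
  rewrite subrKC -subr_gt0 opprK subrK => /(_ Zs).
  set Z := likelihood_ratio s; set n := plays s => h1 n0 nT h2.
  have B0 : 0 <= 1 / 8 - 9 + 9 * (Z + - ln Z) by lra.
  have : (Z - 1) * n <= (1 / 8 - 9 + 9 * (Z + - ln Z)) * n.
    by apply: ler_wpM2r => //; lra.
  have : (1 / 8 - 9 + 9 * (Z + - ln Z)) * n <= (1 / 8 - 9 + 9 * (Z + - ln Z)) * T%:R.
    exact: ler_wpM2l.
  by move=> ? ?; lra.
have H := entropy_le T.
have Ki' : T%:R - Ex (tilt eps i) T plays <= x / eps by rewrite ler_pdivlMr// mulrC.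
have : T%:R * Ex (fun=> 1) T (fun s => - ln (likelihood_ratio s)) <=
    T%:R * (3 * eps ^+ 2 * Ex (fun=> 1) T observations).
  exact: ler_wpM2l.
by move=> ?; lra.
Qed.

End Arm.

End LowerBound.

(** [worst_regret] ranges over best arms only, but among finitely many arms a best one exists and
    has the largest regret. *)
Lemma regret_le_worst (R : realType) (V : finType) (E : rel V) (T : nat)
    (A : algorithm R V) (x : R) (L : 'I_T -> V -> R) a :
  loss_sequence L -> (worst_regret E T A < x%:E)%E -> regret E A L a <= x.
Proof.
move=> L01 Wx.
have [b best_b] : exists b, best_arm L b.
  exists [arg min_(b < a) \sum_(t < T) L t b]%O => b.
  by case: arg_minP => // i _ Hi; apply: Hi.
apply: (@le_trans _ _ (regret E A L b)); first by rewrite lerD2l lerN2; apply: best_b.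
rewrite -lee_fin; apply: le_trans (ltW Wx).
by apply: ereal_sup_ubound; exists L, b.
Qed.

(** * Averaging over the independent set *)

Section IndependentSet.
Variables (R : realType) (V : finType) (E : rel V) (I : {set V}) (d : nat).
Hypotheses (degE : forall v, (#|N_out E v| <= d)%N).
Hypotheses (indI : {in I &, forall u v, ~~ E u v}).
Variables (A : algorithm R V) (T : nat) (x : R).
Hypothesis regx : forall L a, loss_sequence L ->
  regret E A (L : 'I_T -> V -> R) a <= x.

Local Notation Ex0 := (expect (fun=> id) (coin_kernel E I A (fun=> 1)) T).

Let K_ge0 := coin_kernel_ge0 E I A (fun=> ler01 : 0 <= (1 : R)).
Let K_sum1 := coin_kernel_sum1 E I A (avg_cst V (1 : R)).

(** Under fair coins the arms of [I] tie, and each play outside [I] loses 1/2 against [i]. *)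
Lemma explorations_le i : i \in I ->
  Ex0 (fun s => \sum_(y <- s) (y.2 \notin I)%:R) <= 2 * x.
Proof.
move=> iI; rewrite mulrC -ler_pdivrMr// mulrC -expectZ.
have := coin_regret_le I (mu := fun=> 1) (fun=> ler01) (avg_cst V (1 : R)) i regx.
apply: le_trans.
rewrite [leLHS](@eq_expect _ _ _ _ _ T _
  (fun s => \sum_(y <- s) 2^-1 * (y.2 \notin I)%:R)); last first.
  by move=> s _; rewrite mulr_sumr.
apply: expect_additive_le => [//|//|s].
rewrite !coin_kernel_sum; apply: ler_sum => v _.
apply: ler_wpM2l; first exact: arm_prob_ge0.
rewrite (avg_coin_gap R v iI) (@eq_avg _ _ _ (fun=> (v \notin I)%:R / 2)) ?avg_cst//.
by move=> w; rewrite /= mul1r mulrC.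
Qed.

Lemma sum_plays_le : \sum_(i in I) Ex0 (plays R i) <= T%:R.
Proof.
rewrite -expect_sum -[leRHS](expect_cst (fun=> id) K_sum1 T); apply: le_expect => // s <-.
rewrite /plays exchange_big /= -sum1_size natr_sum; apply: ler_sum => y _.
have [yI|yI] := boolP (y.2 \in I).
  rewrite (bigD1 y.2) //= eqxx big1 ?addr0// => i /andP[_].
  by rewrite eq_sym => /negbTE ->.
by rewrite big1 ?ler01// => i iI; case: eqP => // yi; rewrite yi iI in yI.
Qed.

(** By independence a play in [I] reveals no arm of [I]; one outside reveals at most [d]. *)
Lemma sum_observations_le i0 : i0 \in I ->
  \sum_(i in I) Ex0 (observations R E i) <= d%:R * (2 * x).
Proof.
move=> iI0; rewrite -expect_sum.
apply: le_trans (ler_wpM2l (ler0n _ d) (explorations_le iI0)).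
rewrite -expectZ; apply: le_expect => // s _.
rewrite /observations exchange_big mulr_sumr; apply: ler_sum => y _ /=.
have [yI|yI] /= := boolP (y.2 \in I).
  by rewrite mulr0 big1// => i iI; rewrite (negbTE (indI yI iI)).
rewrite mulr1 -natr_sum ler_nat; apply: leq_trans (degE y.2).
rewrite -sum1_card big_mkcond [leqRHS]big_mkcond; apply: leq_sum => i _.
by rewrite inE; case: (i \in I); case: (E _ _).
Qed.

Lemma arms_lower_bound (eps : R) i0 : i0 \in I -> 0 < eps -> eps <= 1 / 4 ->
  #|I|%:R * T%:R <= #|I|%:R * (x / eps) + T%:R + #|I|%:R * (T%:R / 8) +
    27 * T%:R * eps ^+ 2 * (d%:R * (2 * x)).
Proof.
move=> iI0 e0 e1.
apply: (@le_trans _ _ (\sum_(i in I) (x / eps + Ex0 (plays R i) + T%:R / 8 +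
    27 * T%:R * eps ^+ 2 * Ex0 (observations R E i)))).
  by rewrite mulr_natl -sumr_const; apply: ler_sum => i iI; apply: arm_lower_bound.
rewrite !big_split /= -[X in _ + X <= _]mulr_sumr !sumr_const -[x / eps *+ _]mulr_natl.
rewrite -[T%:R / 8 *+ _]mulr_natl.
apply: lerD; first by rewrite lerD2r lerD2l sum_plays_le.
apply: ler_wpM2l; first by rewrite mulr_ge0 ?sqr_ge0// mulr_ge0.
exact: sum_observations_le iI0.
Qed.

End IndependentSet.

Lemma minimax_regret_ge (R : realType) (V : finType) (E : rel V) (d T : nat) :
  (0 < d)%N -> undirected E -> (forall v, #|N_out E v| <= d)%N ->
  (exists u v, u != v /\ ~~ E u v) -> (#|V| <= T)%N ->
  (((32 * d%:R * (d%:R + 1))^-1 * #|V|%:R `^ (1 / 3) * T%:R `^ (2 / 3))%:E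
    <= minimax_regret R E T)%E.
Proof.
move=> d0 undE degE nonadj VT.
have [I [indI I2 NI]] := exists_large_independent undE degE nonadj.
have /card_gt0P[i0 iI0] : (0 < #|I|)%N := ltnW I2.
have V0 : (0 < #|V|)%N by apply/card_gt0P; exists i0.
have T0 : (0 < T)%N := leq_trans V0 VT.
pose a : R := #|V|%:R `^ (1 / 3); pose b : R := T%:R `^ (1 / 3).
have a0 : 0 < a by rewrite powR_gt0// ltr0n.
have b0 : 0 < b by rewrite powR_gt0// ltr0n.
have a3 : a ^+ 3 = #|V|%:R by rewrite powR_root.
have b3 : b ^+ 3 = T%:R by rewrite powR_root.
have ab : a <= b by rewrite ge0_ler_powR ?nnegrE ?ler_nat ?divr_ge0.
rewrite -/a powR_fraction// -/b.
apply: le_ereal_inf_tmp => _ [A _ <-]; rewrite leNgt; apply/negP => Wx.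
pose D : R := d%:R; have D1 : 1 <= D by rewrite ler1n.
set x := (X in (X%:E)%E) in Wx.
(* The tilt is [eps = (N / T)^(1/3) / 4], which is at most 1/4 because [#|V| <= T]. *)
have e0 : 0 < a / (4 * b) by rewrite divr_gt0// mulr_gt0.
have e1 : a / (4 * b) <= 1 / 4 by rewrite ler_pdivrMr ?mulr_gt0//; lra.
have := arms_lower_bound degE indI (fun L c L01 => regret_le_worst c L01 Wx) iI0 e0 e1.
have -> : x / (a / (4 * b)) = T%:R * (8 * D * (D + 1))^-1.
  rewrite /x -/D -b3; field.
  by rewrite !gt_eqF//; lra.
have -> : 27 * T%:R * (a / (4 * b)) ^+ 2 * (d%:R * (2 * x)) =
    T%:R * (#|V|%:R / (D + 1)) * (27 / 256).
  rewrite /x -/D -a3; field.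
  by rewrite !gt_eqF//; lra.
have NI' : #|V|%:R / (D + 1) <= #|I|%:R.
  by rewrite ler_pdivrMr ?natr1 -?natrM ?ler_nat//; lra.
have D2 : (8 * D * (D + 1))^-1 <= 1 / 16.
  by rewrite -[leRHS]invrK lef_pV2 ?posrE; nra.
have k2 : 2 <= #|I|%:R :> R by rewrite ler_nat.
have t0 : 0 < T%:R :> R by rewrite ltr0n.
set t := T%:R in t0 *; set k := #|I|%:R in k2 NI' *.
set p := #|V|%:R / _ in NI' *; set q := (8 * D * _)^-1 in D2 *.
(* Relative to [k * t] the right-hand side is at most [1/16 + 1/2 + 1/8 + 27/256 < 1], a
   contradiction; the [1/2] comes from [2 <= k]. *)
have h1 : k * (t * q) <= k * t * (1 / 16).
  by rewrite -mulrA ler_wpM2l ?ler_pM2l//; lra.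
have h2 : t * p <= k * t by rewrite mulrC ler_pM2r.
have h3 : 2 * t <= k * t by rewrite ler_pM2r.
by move=> ?; nra.
Qed.

Theorem corollary21 (R : realType) (d : nat) (hd : (1 <= d)%N) :
  exists c1 c2 : R, [/\ 0 < c1, 0 < c2 &
    forall (V : finType) (E : rel V),
      undirected E -> weakly_observable E ->
      (forall v : V, (#|N_out E v| <= d)%N) ->
      exists T0 : nat, forall T : nat, (T0 <= T)%N ->
        ((c1 * #|V|%:R `^ (1 / 3) * T%:R `^ (2 / 3))%:E
           <= minimax_regret R E T)%E /\
        (minimax_regret R E T
           <= (c2 * #|V|%:R `^ (1 / 3) * T%:R `^ (2 / 3))%:E)%E].
Proof.
exists (32 * d%:R * (d%:R + 1))^-1, 4; split => //.
  by rewrite invr_gt0 !mulr_gt0 ?ltr0n// natr1 ltr0n.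
move=> V E undE /andP[obsE weakE] degE; have [symE irrE] := undE.
(* Without self-loops, a vertex that is not strongly observable misses some vertex other than
   itself. *)
have nonadj : exists u v, u != v /\ ~~ E u v.
  move: weakE; rewrite negb_forall => /existsP[v].
  rewrite negb_or => /andP[_ /eqP nb]; apply: contrapT => /forallNP nE.
  apply: nb; apply/setP => u; rewrite !inE; have [->|uv] := eqVneq u v; first by rewrite irrE.
  by apply/negPn/negP => nEuv; apply: (nE u); exists v.
exists #|V| => T VT; split; first exact: minimax_regret_ge hd undE degE nonadj VT.
apply: minimax_regret_le => // [|v].
  by case: nonadj => u _; apply/card_gt0P; exists u.
move: obsE; rewrite negb_exists => /forallP/(_ v)/set0Pn[u].
by rewrite inE symE => Evu; exists u.
Qed.
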